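(* Let $N=\{1,\dots,n\}$ be a finite set of agents with common signal space $S=[\underline{s},\overline{s}]\subset\mathbb{R}$, signals drawn independently and identically from a distribution $F$ with density $f$ and full support on $S$, and value functions $v_i(s_1,\dots,s_n)=\max(s_1,\dots,s_n)$ for all $i\in N$. Suppose it is mandatory to sell the object, i.e. only mechanisms whose allocation rule satisfies $\sum_{i\in N}q_i(s)=1$ for all $s\in S^n$ are allowed. Let $c_1,\dots,c_n\in[0,1]$ with $\sum_{i\in N}c_i=1$, and let $q_i(s)=c_i$ for all $i\in N$ and all $s\in S^n$. Then there is a payment rule $p$ such that the mechanism $(q,p)$ is optimal (among the allowed mechanisms).
   Context: For a signal profile $s\in S^n$, $s_{-i}$ denotes the signals of the agents other than $i$, $(s_i,s_{-i})=s$, and $f(s)=\prod_{j\in N}f(s_j)$. A mechanism is a pair $(q,p)$ with measurable allocation rules $q_i:S^n\to[0,1]$ and measurable payment rules $p_i:S^n\to\mathbb{R}$, $i\in N$. The net payoff of agent $i$ is $u_i(s_i,s_{-i})=q_i(s_i,s_{-i})v_i(s_i,s_{-i})-p_i(s_i,s_{-i})$. EPIC (ex-post incentive compatible): for all $i$, $s_{-i}$ and $s_i,s_i'\in S$, $u_i(s_i,s_{-i})\ge u_i(s_i',s_{-i})+[v_i(s_i,s_{-i})-v_i(s_i',s_{-i})]q_i(s_i',s_{-i})$. EPIR (ex-post individually rational): $u_i(s_i,s_{-i})\ge 0$ for all $i$, $s_i$, $s_{-i}$. The expected revenue of $(q,p)$ is $\sum_{i\in N}\int_{S^n}p_i(s)f(s)\,ds$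 (well defined in $[-\infty,\infty)$ under EPIR, since then $p_i\le q_iv_i$, which is bounded). Optimal (under mandatory sale): $(q,p)$ satisfies $\sum_i q_i(s)=1$ for all $s$, is EPIC and EPIR, and has expected revenue at least that of any other EPIC and EPIR mechanism $(q',p')$ with $\sum_i q'_i(s)=1$ for all $s$. *)

(* Defs.v *)
From HB Require Import structures.
From mathcomp Require Import all_boot all_order all_algebra.
From mathcomp Require Import all_classical all_reals all_analysis.

Set Implicit Arguments.
Unset Strict Implicit.
Unset Printing Implicit Defensive.

Import Order.TTheory GRing.Theory Num.Theory.
Import numFieldNormedType.Exports.

Local Open Scope classical_set_scope.
Local Open Scope ring_scope.

(* The library has binary products of measures and a measurable structure on
   tuples (generated by the projections), but no n-fold product measure. The
   n-dimensional Lebesgue measure is the image of the product of the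
   1-dimensional and the (n-1)-dimensional one under (x, s) |-> x :: s;
   lebesgue_tuple_box below is its characteristic property. *)
Section LebesgueTuple.
Context {R : realType}.

Definition tuple_cons n (xs : measurableTypeR R * n.-tuple (measurableTypeR R))
  : n.+1.-tuple (measurableTypeR R) := [tuple of xs.1 :: xs.2].

Lemma measurable_tuple_cons n : measurable_fun setT (@tuple_cons n).
Proof. exact: (measurable_cons measurable_fst measurable_snd). Qed.

Section Step.
Variables (n : nat)
  (m : {sigma_finite_measure set (n.-tuple (measurableTypeR R)) -> \bar R}).

Definition lebesgue_tupleS : set (n.+1.-tuple (measurableTypeR R)) -> \bar R :=
  pushforward (@lebesgue_measure R \x m)%E (@tuple_cons n).

Let lebesgue_tupleS0 : lebesgue_tupleS set0 = 0%E.
Proof. by rewrite /lebesgue_tupleS /pushforward preimage_set0 measure0. Qed.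

Let lebesgue_tupleS_ge0 A : (0 <= lebesgue_tupleS A)%E.
Proof. exact: (measure_ge0 (@lebesgue_measure R \x m)%E). Qed.

Let lebesgue_tupleS_sigma_additive : semi_sigma_additive lebesgue_tupleS.
Proof.
move=> G mG tG mUG; rewrite /lebesgue_tupleS /pushforward preimage_bigcup.
have mcons B : measurable B -> measurable (@tuple_cons n @^-1` B).
  by move=> mB; rewrite -[X in measurable X]setTI; exact: measurable_tuple_cons.
apply: measure_semi_sigma_additive.
- by move=> k; exact: mcons.
- apply/trivIsetP => /= i j _ _ ij; rewrite -preimage_setI.
  by move/trivIsetP : tG => /(_ _ _ _ _ ij) ->//; rewrite preimage_set0.
- by rewrite -preimage_bigcup; exact: mcons.
Qed.

HB.instance Definition _ := isMeasure.Build _ _ _ lebesgue_tupleS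
  lebesgue_tupleS0 lebesgue_tupleS_ge0 lebesgue_tupleS_sigma_additive.

Let lebesgue_tupleS_sigma_finite : sigma_finite setT lebesgue_tupleS.
Proof.
have /sigma_finiteP[G [GT ndG Gfin]] := sigma_finiteT (@lebesgue_measure R).
have /sigma_finiteP[H [HT ndH Hfin]] := sigma_finiteT m.
pose tl (s : n.+1.-tuple (measurableTypeR R)) : n.-tuple (measurableTypeR R) :=
  [tuple of behead s].
exists (fun k => (fun s => tnth s ord0) @^-1` G k `&` tl @^-1` H k).
  apply/seteqP; split => // s _.
  have [j _ Gj] : (\bigcup_k G k) (tnth s ord0) by rewrite -GT.
  have [k _ Hk] : (\bigcup_k H k) (tl s) by rewrite -HT.
  exists (maxn j k) => //; split.
    have /subsetPset := ndG _ _ (leq_maxl j k); exact.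
  have /subsetPset := ndH _ _ (leq_maxr j k); exact.
move=> k; have [mG Gk] := Gfin k; have [mH Hk] := Hfin k; split.
  apply: measurableI; rewrite -[X in measurable X]setTI.
    exact: (@measurable_tnth _ (measurableTypeR R)).
  exact: (@measurable_behead _ (measurableTypeR R)).
rewrite /lebesgue_tupleS /pushforward (_ : _ @^-1` _ = G k `*` H k).
  by rewrite product_measure1E// lte_mul_pinfty// ge0_fin_numE.
have tlK x s : tl (tuple_cons (x, s)) = s by exact/val_inj.
by apply/seteqP; split => -[x s] /=; rewrite tlK.
Qed.

HB.instance Definition _ :=
  Measure_isSigmaFinite.Build _ _ _ lebesgue_tupleS lebesgue_tupleS_sigma_finite.

End Step.

Fixpoint lebesgue_tuple n
    : {sigma_finite_measure set (n.-tuple (measurableTypeR R)) -> \bar R} :=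
  if n is n'.+1 then lebesgue_tupleS (lebesgue_tuple n')
  else \d_[tuple].

Lemma lebesgue_tuple_box n (A : 'I_n -> set (measurableTypeR R)) :
  (forall i, measurable (A i)) ->
  lebesgue_tuple n [set s | forall i, A i (tnth s i)] =
  (\prod_(i < n) @lebesgue_measure R (A i))%E.
Proof.
elim: n A => [|n IHn] A mA.
  by rewrite big_ord0 /= diracE mem_set//= => -[].
rewrite big_ord_recl -IHn//.
have mB : measurable [set s : n.-tuple (measurableTypeR R) |
    forall i, A (lift ord0 i) (tnth s i)].
  rewrite (_ : [set _ | _] = \bigcap_(i in [set: 'I_n])
      ((fun s => tnth s i) @^-1` A (lift ord0 i))); last first.
    by apply/seteqP; split => s /= H i; [move=> _; exact: H|exact: (H i)].
  apply: fin_bigcap_measurable => [|i _]; first exact: finite_finset.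
  rewrite -[X in measurable X]setTI.
  exact: (@measurable_tnth _ (measurableTypeR R)).
rewrite -product_measure1E//= /lebesgue_tupleS /pushforward; congr (_ _).
apply/seteqP; split => [[x s]|[x s] [/= Ax As]] /=.
  move=> H; split => [|i]; first exact: (H ord0).
  by have := H (lift ord0 i); rewrite tnthS.
move=> i; case: (unliftP ord0 i) => [j ->|->]; first by rewrite tnthS.
exact: Ax.
Qed.

End LebesgueTuple.

Section Distribution.
Context {R : realType}.
Implicit Types (F : probability (measurableTypeR R) R) (f : R -> R).

Definition is_density F f :=
  [/\ measurable_fun setT f,
      forall x, 0 <= f x &
      forall A : set (measurableTypeR R), measurable A ->
        F A = (\int[lebesgue_measure]_(x in A) (f x)%:E)%E].

Definition distribution_support F : set R :=
  [set x | forall U : set R, open U -> U x -> (0 < F U)%E].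

Definition full_support F (S : set R) := F S = 1%E /\ distribution_support F = S.

End Distribution.

(* Allocation rules, payment rules and value functions are total functions on
   R^n, but only their values on the set S^n of signal profiles, with
   S = [a, b], are ever constrained or used. *)
Section Auction.
Context {R : realType} {n : nat}.
Local Notation profile := (n.-tuple (measurableTypeR R)).

Definition profiles (a b : R) : set profile :=
  [set s | forall j, a <= tnth s j <= b].

(* (x, s_{-i}) *)
Definition deviate (s : profile) (i : 'I_n) (x : R) : profile :=
  [tuple if j == i then x else tnth s j | j < n].

(* The default value of the big operator is the first signal, so that this is
   max(s_1, ..., s_n) also for negative signals. *)
Definition max_signal (s : profile) : R :=
  \big[Num.max/head 0 s]_(j < n) tnth s j.

Variables (a b : R) (v : 'I_n -> profile -> R) (f : R -> R).
Implicit Types (q p : 'I_n -> profile -> R).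

Definition net_payoff q p (i : 'I_n) (s : profile) : R :=
  q i s * v i s - p i s.

Definition mechanism q p := forall i,
  [/\ measurable_fun (profiles a b) (q i),
      measurable_fun (profiles a b) (p i) &
      forall s, profiles a b s -> 0 <= q i s <= 1].

Definition EPIC q p :=
  forall (i : 'I_n) (s : profile) (x' : R),
    profiles a b s -> a <= x' <= b ->
    let s' := deviate s i x' in
    net_payoff q p i s' + (v i s - v i s') * q i s' <= net_payoff q p i s.

Definition EPIR q p :=
  forall (i : 'I_n) (s : profile), profiles a b s -> 0 <= net_payoff q p i s.

Definition mandatory_sale q :=
  forall s, profiles a b s -> \sum_(i < n) q i s = 1.

(* The integrals are those of extended-real-valued functions: under EPIR and
   for bounded v the positive part of the integrand is integrable, so that
   each of them lies in [-oo, +oo[. *)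
Definition revenue p : \bar R :=
  (\sum_(i < n) \int[lebesgue_tuple n]_(s in profiles a b)
     (p i s * \prod_(j < n) f (tnth s j))%:E)%E.

Definition admissible q p :=
  [/\ mechanism q p, mandatory_sale q, EPIC q p & EPIR q p].

Definition optimal q p :=
  admissible q p /\
  forall q' p', admissible q' p' -> (revenue p' <= revenue p)%E.

End Auction.

(* Main.v *)
(* Let m_i be the highest signal of the agents other than i, and let agent i
   pay c_i m_i. In an arbitrary admissible mechanism, agent i's rent at s is at
   least the integral of q_i(t, s_{-i}) over m_i < t < s_i. EPIC also gives
   q_i(t, s_{-i}) >= q_i(x, s_{-i}) whenever m_i < t and x < t; averaging over
   x conditionally on x < t and summing over i yields, because the object is
   always sold,
     P(s_i < t) * sum_i E[1{m_i < t} q_i(t, s_{-i})] >= P(max s < t),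
   which is an equality for the constant allocation rule. So no admissible
   mechanism leaves less expected rent to the agents. The integral over t is
   replaced by sums over a grid whose mesh tends to 0. *)

Require Import Defs.
From mathcomp Require Import all_boot all_order all_algebra.
From mathcomp Require Import all_classical all_reals all_analysis.
From mathcomp Require Import measurable_realfun lra.

Set Implicit Arguments.
Unset Strict Implicit.
Unset Printing Implicit Defensive.

Import Order.TTheory GRing.Theory Num.Theory.
Import numFieldNormedType.Exports.

Local Open Scope classical_set_scope.
Local Open Scope ring_scope.

(** * Maxima of signal profiles and unilateral deviations *)

Section Signals.
Context {R : realType} {n : nat}.
Local Notation profile := (n.-tuple (measurableTypeR R)).
Implicit Types (s : profile) (i j : 'I_n) (x y a b : R).

(** The agent [i] witnesses [0 < n]. The default value of the big maximum is then itself a signal,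
    so it cannot distort the maximum, whatever the signs. *)
Lemma max_signal_head i s : exists j, head 0 s = tnth s j.
Proof.
case: n i s => [[]//|m] _ s; exists ord0.
by rewrite (tnth_nth 0) /= nth0.
Qed.

Lemma max_signal_leP i s x : max_signal s <= x <-> forall j, tnth s j <= x.
Proof.
have [k hk] := max_signal_head i s.
rewrite /max_signal hk; split => [/bigmax_leP[_ H] j|H]; first exact: H.
by apply/bigmax_leP; split.
Qed.

Lemma max_signal_ltP i s x : max_signal s < x <-> forall j, tnth s j < x.
Proof.
have [k hk] := max_signal_head i s.
rewrite /max_signal hk; split => [/bigmax_ltP[_ H] j|H]; first exact: H.
by apply/bigmax_ltP; split.
Qed.

Lemma tnth_deviate s i x j :
  tnth (deviate s i x) j = if j == i then x else tnth s j.
Proof. by rewrite tnth_mktuple. Qed.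

Lemma deviate_deviate s i x y : deviate (deviate s i x) i y = deviate s i y.
Proof.
by apply: eq_from_tnth => j; rewrite !tnth_deviate; case: eqP.
Qed.

Lemma deviate_id s i : deviate s i (tnth s i) = s.
Proof.
by apply: eq_from_tnth => j; rewrite !tnth_deviate; case: eqP => [->|].
Qed.

(** Lowering signal [i] to [a] stands in for deleting it: any [x >= a] absorbs the [a] left in its
    place. So [max_signal (deviate s i a)] can serve as the highest competing signal. *)
Lemma max_signal_deviate a s i x : a <= x ->
  max_signal (deviate s i x) = Num.max x (max_signal (deviate s i a)).
Proof.
move=> ax; apply/eqP; rewrite eq_le; apply/andP; split.
  apply/(max_signal_leP i) => j; rewrite tnth_deviate le_max.
  case: eqP => [_|/eqP ji]; first by rewrite lexx.
  have /(max_signal_leP i)/(_ j) := lexx (max_signal (deviate s i a)).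
  by rewrite tnth_deviate (negPf ji) => ->; rewrite orbT.
have /(max_signal_leP i) h := lexx (max_signal (deviate s i x)).
rewrite ge_max; apply/andP; split.
  by have := h i; rewrite tnth_deviate eqxx.
apply/(max_signal_leP i) => j; have := h j; rewrite !tnth_deviate.
by case: eqP => // _; exact: le_trans.
Qed.

Lemma max_signalE a s i : a <= tnth s i ->
  max_signal s = Num.max (tnth s i) (max_signal (deviate s i a)).
Proof. by move=> h; rewrite -(max_signal_deviate s i h) deviate_id. Qed.

Lemma profiles_deviate a b s i x :
  profiles a b s -> a <= x <= b -> profiles a b (deviate s i x).
Proof. by move=> Ds axb j; rewrite tnth_deviate; case: eqP. Qed.

Lemma max_signal_bounds i a b s : profiles a b s -> a <= max_signal s <= b.
Proof.
move=> Ds; have /(max_signal_leP i)/(_ i) h := lexx (max_signal s).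
have /andP[ai _] := Ds i; rewrite (le_trans ai h)/=.
by apply/(max_signal_leP i) => j; have /andP[] := Ds j.
Qed.

Lemma measurable_max_signal : measurable_fun setT (@max_signal R n).
Proof.
case: n => [|m].
  rewrite (_ : max_signal = cst 0)//.
  by apply/funext => z; rewrite /max_signal big_ord0 (tuple0 z).
(* With the default written as a coordinate, an induction over the index list starts from a
   measurable function. *)
rewrite (_ : max_signal = fun z : m.+1.-tuple (measurableTypeR R) =>
    \big[Num.max/tnth z ord0]_(j < m.+1) tnth z j); last first.
  by apply/funext => z; rewrite /max_signal (tnth_nth 0) nth0.
elim: (index_enum _) => [|k r IH].
  rewrite (_ : (fun _ => _) = fun z : m.+1.-tuple (measurableTypeR R) => tnth z ord0).
    exact: (@measurable_tnth _ (measurableTypeR R)).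
  by apply/funext => z; rewrite big_nil.
rewrite (_ : (fun _ => _) = (fun z : m.+1.-tuple (measurableTypeR R) => tnth z k)
  \max (fun z => \big[Num.max/tnth z ord0]_(j <- r) tnth z j)).
  by apply: measurable_maxr => //; exact: (@measurable_tnth _ (measurableTypeR R)).
by apply/funext => z; rewrite big_cons.
Qed.

Lemma measurable_deviate i x :
  measurable_fun setT (fun s : profile => deviate s i x).
Proof.
apply/measurable_fun_tnthP => j.
have [->|ji] := eqVneq j i.
  rewrite (_ : _ \o _ = cst x)//.
  by apply/funext => s /=; rewrite tnth_deviate eqxx.
rewrite (_ : _ \o _ = fun s : profile => tnth s j).
  exact: (@measurable_tnth _ (measurableTypeR R)).
by apply/funext => s /=; rewrite tnth_deviate (negPf ji).
Qed.

Lemma measurable_profiles a b : measurable (profiles (n := n) a b).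
Proof.
rewrite (_ : profiles a b = \bigcap_(i in [set: 'I_n])
      ((fun s : profile => tnth s i) @^-1` `[a, b])); last first.
  apply/seteqP; split => z H i => [_|]; first by rewrite /= in_itv/=; exact: H.
  by have := H i I; rewrite /= in_itv.
apply: fin_bigcap_measurable => [|i _]; first exact: finite_finset.
rewrite -[X in measurable X]setTI.
by apply: (@measurable_tnth _ (measurableTypeR R)) => //; exact: measurable_itv.
Qed.

End Signals.

(** * Pointwise estimates along a grid of signals *)

Section Grid.
Context {R : realType} {n : nat}.
Local Notation profile := (n.-tuple (measurableTypeR R)).
Local Notation value := (fun _ : 'I_n => @max_signal R n).
Variables (a b d : R).
Hypothesis d_ge0 : 0 <= d.
Implicit Types (s : profile) (i j : 'I_n) (k J : nat).

(* The grid starts at [a + d], so that signals below any grid point have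
   positive probability. *)
Definition grid k : R := a + d * k.+1%:R.

Definition crosses s i k : bool :=
  (max_signal (deviate s i a) < grid k) && (grid k.+1 <= tnth s i).

Lemma gridS k : grid k.+1 = grid k + d.
Proof. by rewrite /grid -(natr1 k.+1) mulrDr mulr1 addrA. Qed.

Lemma grid_ge k : a <= grid k.
Proof. by rewrite /grid lerDl mulr_ge0. Qed.

Lemma le_grid k l : (k <= l)%N -> grid k <= grid l.
Proof. by move=> kl; rewrite /grid lerD2l ler_wpM2l// ler_nat ltnS. Qed.

(** Adding the two incentive constraints between [s] and [deviate s i t] gives that the changes in
    value and in allocation have a nonnegative product. The value strictly increases because [t]
    exceeds every signal of [s]. *)
Lemma EPIC_le (q p : 'I_n -> profile -> R) i s (t : R) :
  EPIC a b value q p -> profiles a b s -> a <= t <= b ->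
  (forall j, tnth s j < t) -> q i s <= q i (deviate s i t).
Proof.
move=> ic Ds tab st.
have /(max_signal_ltP i) Mt := st.
have Dt := profiles_deviate i Ds tab.
have := ic i s t Ds tab; have := ic i _ (tnth s i) Dt (Ds i).
rewrite /= deviate_deviate deviate_id.
set s' := deviate s i t.
have vs' : t <= max_signal s'.
  have /(max_signal_leP i)/(_ i) := lexx (max_signal s').
  by rewrite tnth_deviate eqxx.
move=> h1 h2.
have h : 0 <= (max_signal s' - max_signal s) * (q i s' - q i s) by lra.
by rewrite -subr_ge0 -(pmulr_rge0 _ (_ : 0 < max_signal s' - max_signal s))//; lra.
Qed.

(* A discrete envelope formula: above the highest competing signal, the
   agent's rent grows at rate at least q_i. *)
Lemma net_payoff_ge (q p : 'I_n -> profile -> R) i s J :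
  EPIC a b value q p -> EPIR a b value q p ->
  (forall s', profiles a b s' -> 0 <= q i s') -> profiles a b s ->
  d * \sum_(k < J) (crosses s i k)%:R * q i (deviate s i (grid k))
    <= net_payoff value q p i s.
Proof.
move=> ic ir q_ge0; elim: J s => [|J IH] s Ds.
  by rewrite big_ord0 mulr0; exact: ir.
rewrite big_ord_recr/=; case: (boolP (crosses s i J)) => cJ; last first.
  by rewrite mul0r addr0; exact: IH.
have /andP[mJ Js] := cJ; have /andP[asi sib] := Ds i.
have tab : a <= grid J <= b.
  by rewrite grid_ge (le_trans _ sib)// (le_trans _ Js)// le_grid.
have Dt := profiles_deviate i Ds tab.
have := ic i s _ Ds tab; cbv zeta.
have := IH _ Dt.
(* For [k < J] the own signal is at least [grid k.+1] both in [s] and after lowering it to [grid J],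
   so the two profiles cross the same cells and the induction hypothesis yields the sum for [s]. *)
rewrite (eq_bigr (fun k : 'I_J =>
    (crosses s i k)%:R * q i (deviate s i (grid k)))) => [|k _]; last first.
  rewrite deviate_deviate /crosses deviate_deviate tnth_deviate eqxx.
  by rewrite le_grid// (le_trans _ Js)//; apply: le_grid; rewrite ltnW// ltnS.
(* Both own signals exceed the competing ones, so the values are the own signals and their
   difference is at least [d]. *)
rewrite (max_signalE asi) (max_signal_deviate _ _ (grid_ge J)).
rewrite (max_idPl (ltW mJ)) (max_idPl _); last first.
  by rewrite (le_trans (ltW mJ))// (le_trans _ Js)// le_grid.
set Q := q i _; set u' := net_payoff _ _ _ _ (deviate _ _ _).
set u := net_payoff _ _ _ _ _; set S := \sum_(_ < _) _; rewrite gridS in Js.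
have : 0 <= (tnth s i - (grid J + d)) * Q.
  by rewrite mulr_ge0 ?subr_ge0// /Q q_ge0.
rewrite mul1r; lra.
Qed.

(** Beyond [m], each new grid point adds [d] to both sides. The extra [d] pays for the cell in which
    [m] lies; it also covers the start of the grid at [a + d]. *)
Lemma le_grid_count (m : R) J : a <= m ->
  grid J - m <= d * \sum_(k < J) (m < grid k)%R%:R + d.
Proof.
move=> am; elim: J => [|J IH].
  by rewrite big_ord0 mulr0 add0r /grid mulr1; lra.
rewrite big_ord_recr/= gridS mulrDr; case: ltP => mJ.
  by rewrite mulr1; lra.
have : 0 <= d * \sum_(k < J) (m < grid k)%R%:R.
  by rewrite mulr_ge0// sumr_ge0.
by rewrite mulr0; lra.
Qed.

(** The crossed cells fill the interval from the highest competing signal to signal [i], except for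
    an incomplete cell at each end; hence the error [d *+ 2]. *)
Lemma max_signal_gap_le s i J : a <= tnth s i <= grid J ->
  a <= max_signal (deviate s i a) ->
  max_signal s - max_signal (deviate s i a)
    <= d * \sum_(k < J) (crosses s i k)%:R + d *+ 2.
Proof.
move=> /andP[asi siJ] am.
rewrite (max_signalE asi) /crosses; move: am asi siJ.
move: (max_signal _) => m; move: (tnth s i : R) => x am asi siJ.
have S_ge0 L : 0 <= d * \sum_(k < L) ((m < grid k) && (grid k.+1 <= x))%:R.
  by rewrite mulr_ge0// sumr_ge0.
suff : x - m <= d * \sum_(k < J) ((m < grid k) && (grid k.+1 <= x))%:R + d *+ 2.
  by case: (leP x m) => // _ _; rewrite subrr addr_ge0// mulrn_wge0.
(* The induction locates the cell of [x]: once [grid J < x], all cells below [grid J] satisfy the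
   upper condition, and only the grid points above [m] are left to count. *)
elim: J siJ => [|J IH] siJ.
  by move: siJ; rewrite big_ord0 mulr0 add0r /grid mulr1 mulr2n; lra.
case: (leP x (grid J)) => xJ.
  rewrite (le_trans (IH xJ))// lerD2r ler_wpM2l// big_ord_recr/=.
  by rewrite lerDl.
have := le_grid_count J am; rewrite big_ord_recr/= mulrDr mulr2n.
have -> : \sum_(k < J) ((m < grid k) && (grid k.+1 <= x))%:R
  = \sum_(k < J) (m < grid k)%R%:R :> R.
  apply: eq_bigr => k _; rewrite (_ : (_ <= x) = true) ?andbT//.
  by rewrite (le_trans _ (ltW xJ))// le_grid.
have : 0 <= d * ((m < grid J) && (grid J.+1 <= x))%:R by rewrite mulr_ge0.
by move: siJ; rewrite gridS; lra.
Qed.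

End Grid.

(** * Product densities and independence of the coordinates *)

Section Independence.
Context {R : realType}.
Local Notation mR := (measurableTypeR R).
Variable f : mR -> R.
Hypotheses (mf : measurable_fun setT f) (f_ge0 : forall x, 0 <= f x).

Definition prod_density n (s : n.-tuple mR) : R := \prod_(j < n) f (tnth s j).

Lemma prod_density_ge0 n (s : n.-tuple mR) : 0 <= prod_density s.
Proof. by apply: prodr_ge0 => j _; exact: f_ge0. Qed.

Lemma measurable_prod_density n : measurable_fun setT (@prod_density n).
Proof.
apply: measurable_prod => j _; apply: measurableT_comp => //.
exact: (@measurable_tnth _ mR).
Qed.

Lemma measurable_tuple_cons_section n (x : mR) :
  measurable_fun setT (fun s : n.-tuple mR => tuple_cons (x, s)).
Proof. exact: (measurable_cons (measurable_cst x) (@measurable_id _ _ setT)). Qed.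

(** Tonelli's theorem, transported along the pushforward that defines [lebesgue_tuple]; the first
    factor of the density leaves the inner integral. *)
Lemma integral_tuple_cons n (h : n.+1.-tuple mR -> R) :
  measurable_fun setT h -> (forall s, 0 <= h s) ->
  (\int[lebesgue_tuple n.+1]_s (h s * prod_density s)%:E =
   \int[lebesgue_measure]_x
     ((f x)%:E *
      \int[lebesgue_tuple n]_s (h (tuple_cons (x, s)) * prod_density s)%:E))%E.
Proof.
move=> mh h_ge0.
have mhd : measurable_fun setT (fun s => (h s * prod_density s)%:E).
  by apply/measurable_EFinP; apply: measurable_funM => //; exact: measurable_prod_density.
have hd_ge0 s : (0 <= (h s * prod_density s)%:E)%E.
  by rewrite lee_fin mulr_ge0 ?prod_density_ge0.
rewrite [LHS](ge0_integral_pushforward (@measurable_tuple_cons R n)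
  (@lebesgue_measure R \x lebesgue_tuple n)%E)//.
rewrite preimage_setT fubini_tonelli1//; last 2 first.
- exact: measurableT_comp mhd (@measurable_tuple_cons R n).
- by move=> x; exact: hd_ge0.
apply: eq_integral => x _.
rewrite -ge0_integralZl//.
- apply: eq_integral => s _; rewrite -EFinM /=; congr EFin.
  rewrite {1}/prod_density big_ord_recl mulrCA; congr (_ * (_ * _)).
  by apply: eq_bigr => j _; rewrite tnthS.
- apply/measurable_EFinP; apply: measurable_funM.
    exact: measurableT_comp mh (measurable_tuple_cons_section _).
  exact: measurable_prod_density.
- by move=> s _; rewrite lee_fin mulr_ge0 ?prod_density_ge0.
- by rewrite lee_fin f_ge0.
Qed.

Hypothesis f_prob : (\int[lebesgue_measure]_x (f x)%:E = 1)%E.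

(** That [g] depends on the other coordinates only is expressed as invariance under [deviate]. The
    induction splits off the first coordinate, which either differs from [i] or is [i]. *)
Lemma integral_prod_density_indep n (i : 'I_n) (k : mR -> R) (g : n.-tuple mR -> R) :
  measurable_fun setT k -> (forall x, 0 <= k x) ->
  measurable_fun setT g -> (forall s, 0 <= g s) ->
  (forall s x, g (deviate s i x) = g s) ->
  (\int[lebesgue_tuple n]_s (k (tnth s i) * g s * prod_density s)%:E =
   \int[lebesgue_measure]_x (k x * f x)%:E *
     \int[lebesgue_tuple n]_s (g s * prod_density s)%:E)%E.
Proof.
move=> mk k_ge0; elim: n => [|n IH] in i g *; first by case: i.
move=> mg g_ge0 gi.
have mki : measurable_fun setT (fun s : n.+1.-tuple mR => k (tnth s i)).
  by apply: measurableT_comp => //; exact: (@measurable_tnth _ mR).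
rewrite (@integral_tuple_cons _ (fun s => k (tnth s i) * g s)); last 2 first.
- exact: measurable_funM.
- by move=> s; rewrite mulr_ge0.
rewrite integral_tuple_cons//.
have mgd (x : mR) : measurable_fun setT (fun s : n.-tuple mR =>
    (g (tuple_cons (x, s)) * prod_density s)%:E).
  apply/measurable_EFinP; apply: measurable_funM; last exact: measurable_prod_density.
  exact: measurableT_comp mg (measurable_tuple_cons_section _).
have gd_ge0 (x : mR) (s : n.-tuple mR) :
    (0 <= (g (tuple_cons (x, s)) * prod_density s)%:E)%E.
  by rewrite lee_fin mulr_ge0 ?prod_density_ge0.
have kf_ge0 : (0 <= \int[lebesgue_measure]_x (k x * f x)%:E)%E.
  by apply: integral_ge0 => x _; rewrite lee_fin mulr_ge0.
case: (unliftP ord0 i) => [j ij|i0].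
(* Coordinate [i] lies in the tail: each section of [g] at a fixed first coordinate inherits the
   invariance, so the induction hypothesis applies under the outer integral. *)
- have gj (x : mR) (s : n.-tuple mR) y :
      g (tuple_cons (x, deviate s j y)) = g (tuple_cons (x, s)).
    rewrite -(gi (tuple_cons (x, s)) y); congr g.
    apply: eq_from_tnth => l; rewrite tnth_deviate ij.
    case: (unliftP ord0 l) => [l' ->|->].
      by rewrite !tnthS tnth_deviate (inj_eq lift_inj).
    by rewrite (negPf (neq_lift ord0 j)).
  rewrite -ge0_integralZl//; last 2 first.
  + apply: emeasurable_funM; first exact/measurable_EFinP.
    apply: (measurable_fun_fubini_tonelli_F (m2 := lebesgue_tuple n)
      (fun z : mR * n.-tuple mR => (g (tuple_cons z) * prod_density z.2)%:E)).
      apply/measurable_EFinP; apply: measurable_funM.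
        exact: measurableT_comp mg (@measurable_tuple_cons R n).
      by apply: measurableT_comp; [exact: measurable_prod_density|].
    by move=> [x s]; exact: gd_ge0.
  + move=> x _; rewrite mule_ge0// ?lee_fin ?f_ge0//.
    by apply: integral_ge0 => s _.
  apply: eq_integral => x _; rewrite muleCA; congr (_ * _)%E.
  rewrite -(IH j (fun s => g (tuple_cons (x, s))))//.
  + by apply: eq_integral => s _; rewrite ij tnthS.
  + exact: measurableT_comp mg (measurable_tuple_cons_section _).
(* Coordinate [i] is the first: the sections of [g] all coincide, and [0] is an arbitrary reference
   point. The inner integral is then a constant [G]. *)
- have g0 (x : mR) (s : n.-tuple mR) : g (tuple_cons (x, s)) = g (tuple_cons (0, s)).
    rewrite -(gi (tuple_cons (0, s)) x); congr g; apply: eq_from_tnth => l.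
    rewrite tnth_deviate i0; case: (unliftP ord0 l) => [l' ->|->].
      by rewrite !tnthS eq_sym (negPf (neq_lift _ _)).
    by rewrite eqxx.
  pose G := (\int[lebesgue_tuple n]_s (g (tuple_cons (0, s)) * prod_density s)%:E)%E.
  have G_ge0 : (0 <= G)%E by apply: integral_ge0 => s _.
  transitivity (\int[lebesgue_measure]_x ((k x * f x)%:E * G))%E.
    apply: eq_integral => x _; rewrite mulrC EFinM -muleA; congr (_ * _)%E.
    rewrite /G -ge0_integralZl// ?lee_fin//.
    by apply: eq_integral => s _; rewrite i0 -EFinM mulrA g0.
  rewrite ge0_integralZr//; last 2 first.
  + by apply/measurable_EFinP; exact: measurable_funM.
  + by move=> x _; rewrite lee_fin mulr_ge0.
  congr (_ * _)%E.
  under eq_integral do under eq_integral do rewrite g0.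
  rewrite ge0_integralZr ?f_prob ?mul1e//; first exact/measurable_EFinP.
  by move=> x _; rewrite lee_fin.
Qed.

Lemma integral_prod_density n :
  (\int[lebesgue_tuple n]_s (prod_density s)%:E = 1)%E.
Proof.
elim: n => [|n IH].
  rewrite integral_dirac//; last first.
    by apply/measurable_EFinP; exact: measurable_prod_density.
  by rewrite diracT mul1e /prod_density big_ord0.
under eq_integral do rewrite -[prod_density _]mul1r.
rewrite (@integral_tuple_cons _ (cst 1))//.
under eq_integral => x _ do (under eq_integral do rewrite mul1r; rewrite IH mule1).
exact: f_prob.
Qed.

End Independence.

(** * Bounded measurable functions on a set *)

Section BoundedMeasurable.
Context d {T : measurableType d} {R : realType} (D : set T).
Implicit Types h g : T -> R.

(** A condition stable under algebraic operations that ensures integrability against a probability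
    density. It is relative to [D] because mechanisms are constrained only on S^n. *)
Definition bounded_measurable h :=
  measurable_fun D h /\ exists C, forall x, D x -> `|h x| <= C.

Lemma bounded_measurable_cst r : bounded_measurable (cst r).
Proof. by split; [exact: measurable_cst|exists `|r|]. Qed.

Lemma bounded_measurableD h g : bounded_measurable h -> bounded_measurable g ->
  bounded_measurable (fun x => h x + g x).
Proof.
move=> [mh [C hC]] [mg [C' gC]]; split; first exact: measurable_funD.
by exists (C + C') => x Dx; rewrite (le_trans (ler_normD _ _))// lerD ?hC ?gC.
Qed.

Lemma bounded_measurableM h g : bounded_measurable h -> bounded_measurable g ->
  bounded_measurable (fun x => h x * g x).
Proof.
move=> [mh [C hC]] [mg [C' gC]]; split; first exact: measurable_funM.
by exists (C * C') => x Dx; rewrite normrM ler_pM ?hC ?gC.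
Qed.

Lemma bounded_measurableZ r h : bounded_measurable h ->
  bounded_measurable (fun x => r * h x).
Proof. exact: bounded_measurableM (bounded_measurable_cst r). Qed.

Lemma bounded_measurableB h g : bounded_measurable h -> bounded_measurable g ->
  bounded_measurable (fun x => h x - g x).
Proof.
move=> bh /(bounded_measurableZ (-1)) bg.
by have := bounded_measurableD bh bg; under eq_fun do rewrite mulN1r.
Qed.

Lemma bounded_measurable_sum I (r : seq I) (h : I -> T -> R) :
  (forall i, bounded_measurable (h i)) ->
  bounded_measurable (fun x => \sum_(i <- r) h i x).
Proof.
move=> bh; elim: r => [|i r IH].
  by under eq_fun do rewrite big_nil; exact: bounded_measurable_cst.
by under eq_fun do rewrite big_cons; exact: bounded_measurableD.
Qed.

Lemma measurable_fun_boolr (c : T -> bool) : measurable_fun setT c ->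
  measurable_fun setT (fun x => (c x)%:R : R).
Proof.
move=> mc; rewrite (_ : (fun _ => _) = fun x => if c x then 1 else 0); last first.
  by apply/funext => x; case: (c x).
exact: measurable_fun_ifT.
Qed.

Lemma bounded_measurable_bool (c : T -> bool) : measurable_fun setT c ->
  bounded_measurable (fun x => (c x)%:R).
Proof.
move=> mc; split; first exact: measurable_funTS (measurable_fun_boolr mc).
by exists 1 => x _; case: (c x); rewrite ?normr1 ?normr0.
Qed.

End BoundedMeasurable.

(** * Expectations over signal profiles *)

Section Expectation.
Context {R : realType}.
Local Notation mR := (measurableTypeR R).
Variables (n : nat) (a b : R) (F : probability mR R) (f : mR -> R).
Hypotheses (Ff : is_density F f) (supF : full_support F `[a, b]).
Local Notation profile := (n.-tuple mR).
Local Notation D := (profiles (n := n) a b).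
Local Notation bm := (bounded_measurable D).
Local Notation fab := (f \_ `[a, b]).
Implicit Types (h g : profile -> R) (k : mR -> bool).

Let mf : measurable_fun setT f. Proof. by case: Ff. Qed.
Let f_ge0 x : 0 <= f x. Proof. by case: Ff => _ + _; exact. Qed.

Let mfab : measurable_fun setT fab.
Proof.
apply/(measurable_restrictT _ _).1; first exact: measurable_itv.
exact: measurable_funTS.
Qed.

Let fab_ge0 x : 0 <= fab x.
Proof. by rewrite /patch; case: ifP. Qed.

Lemma integral_fabE (A : set mR) : measurable A ->
  (\int[lebesgue_measure]_(x in A) (fab x)%:E = F (A `&` `[a, b]))%E.
Proof.
move=> mA; have [_ _ ->] := Ff; last by apply: measurableI.
rewrite integral_mkcondr; apply: eq_integral => x _.
by rewrite /patch; case: ifP.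
Qed.

Let fab_prob : (\int[lebesgue_measure]_x (fab x)%:E = 1)%E.
Proof. by rewrite integral_fabE// setTI; case: supF. Qed.

Definition expect h : R :=
  \int[lebesgue_tuple n]_(s in D) (h s * prod_density f s).

Definition prob k : R :=
  \int[lebesgue_measure]_x ((k x)%:R * fab x).

(** The truncated product density vanishes as soon as one signal leaves [[a, b]]. Integrals over S^n
    thus become integrals over the whole space, to which the independence results apply. *)
Lemma integral_profilesE h :
  (\int[lebesgue_tuple n]_(s in D) (h s * prod_density f s)%:E =
   \int[lebesgue_tuple n]_s (h s * prod_density fab s)%:E)%E.
Proof.
rewrite integral_mkcond; apply: eq_integral => s _; rewrite /patch.
case: ifPn => [|]; rewrite ?inE ?notin_setE => Ds.
  congr (_ * _)%:E; apply: eq_bigr => j _.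
  by rewrite ifT// inE /= in_itv/=; exact: Ds.
have [j sj] : exists j, ~ (a <= tnth s j <= b) by exact/existsNP.
rewrite /prod_density (bigD1 j)//= [X in _ * (X * _)](_ : _ = 0) ?mul0r ?mulr0//.
by rewrite ifF//; apply/negbTE; rewrite notin_setE /= in_itv.
Qed.

Let mD : measurable D. Proof. exact: measurable_profiles. Qed.

Let mW : measurable_fun D (@prod_density R f n).
Proof. by apply: measurable_funTS; exact: measurable_prod_density. Qed.

Lemma expect_integrable h : bm h ->
  (lebesgue_tuple n).-integrable D (EFin \o (fun s => h s * prod_density f s)).
Proof.
move=> [mh [C hC]].
apply: (@le_integrable _ _ _ _ _ _ _ (EFin \o (fun s => C * prod_density f s))) => //.
- by apply/measurable_EFinP; exact: measurable_funM.
- move=> s Ds /=; rewrite lee_fin !normrM ler_pM//.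
  by rewrite (le_trans (hC _ Ds))// ler_norm.
apply: (@eq_integrable _ _ _ _ D mD
  (fun s => C%:E * (EFin \o @prod_density R f n) s)%E) => //.
apply: integrableZl => //.
apply/integrableP; split; first exact/measurable_EFinP.
rewrite (eq_integral (fun s => (1 * prod_density f s)%:E)) => [|s _]; last first.
  by rewrite /= ger0_norm ?mul1r ?prod_density_ge0.
rewrite integral_profilesE; under eq_integral do rewrite mul1r.
by rewrite (integral_prod_density mfab fab_ge0 fab_prob) ltry.
Qed.

Lemma expect1 : expect (cst 1) = 1.
Proof.
rewrite /expect /Rintegral integral_profilesE.
under eq_integral do rewrite mul1r.
by rewrite (integral_prod_density mfab fab_ge0 fab_prob).
Qed.

Lemma eq_expect h g : (forall s, D s -> h s = g s) -> expect h = expect g.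
Proof. by move=> hg; apply: eq_Rintegral => s; rewrite inE => /hg ->. Qed.

Lemma le_expect h g : bm h -> bm g -> (forall s, D s -> h s <= g s) ->
  expect h <= expect g.
Proof.
move=> bh bg hg; apply: le_Rintegral => //; try exact: expect_integrable.
by move=> s Ds; rewrite ler_wpM2r ?prod_density_ge0 ?hg.
Qed.

Lemma expectD h g : bm h -> bm g ->
  expect (fun s => h s + g s) = expect h + expect g.
Proof.
move=> bh bg; rewrite -RintegralD//; try exact: expect_integrable.
by apply: eq_Rintegral => s _; rewrite mulrDl.
Qed.

Lemma expectZ r h : bm h -> expect (fun s => r * h s) = r * expect h.
Proof.
move=> bh; rewrite -RintegralZl//; last exact: expect_integrable.
by apply: eq_Rintegral => s _; rewrite mulrA.
Qed.

Lemma expectB h g : bm h -> bm g ->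
  expect (fun s => h s - g s) = expect h - expect g.
Proof.
move=> bh bg; rewrite -RintegralB//; try exact: expect_integrable.
by apply: eq_Rintegral => s _; rewrite mulrBl.
Qed.

Lemma expect_sum I (r : seq I) (h : I -> profile -> R) : (forall i, bm (h i)) ->
  expect (fun s => \sum_(i <- r) h i s) = \sum_(i <- r) expect (h i).
Proof.
move=> bh; elim: r => [|i r IH].
  under eq_expect do rewrite big_nil -(mul0r 1).
  rewrite expectZ ?mul0r ?big_nil//; exact: bounded_measurable_cst.
rewrite big_cons -IH -expectD//; last exact: bounded_measurable_sum.
by apply: eq_expect => s _; rewrite big_cons.
Qed.

Lemma expect_EFin h : bm h ->
  (\int[lebesgue_tuple n]_(s in D) (h s * prod_density f s)%:E = (expect h)%:E)%E.
Proof.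
move=> /expect_integrable ih; rewrite fineK//.
exact: integrable_fin_num ih.
Qed.

(** Meant for payments, which are bounded above but may have integral [-oo]. Positive and negative
    parts are compared separately, so [h] may fail to be integrable. *)
Lemma integral_le_expect h g : measurable_fun D h -> bm g ->
  (forall s, D s -> h s <= g s) ->
  (\int[lebesgue_tuple n]_(s in D) (h s * prod_density f s)%:E <= (expect g)%:E)%E.
Proof.
move=> mh bg hg; rewrite -expect_EFin//; have [mg _] := bg.
have mE (e : profile -> R) : measurable_fun D e ->
    measurable_fun D (fun s => (e s * prod_density f s)%:E).
  by move=> me; apply/measurable_EFinP; exact: measurable_funM.
have le_hg : {in D, forall s,
    ((h s * prod_density f s)%:E <= (g s * prod_density f s)%:E)%E}.
  by move=> s; rewrite inE => Ds; rewrite lee_fin ler_wpM2r ?prod_density_ge0 ?hg.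
rewrite integralE [leRHS]integralE leeB//; apply: ge0_le_integral => //.
- by apply: measurable_funepos; exact: mE.
- by apply: measurable_funepos; exact: mE.
- by move=> s /mem_set; exact: funepos_le.
- by apply: measurable_funeneg; exact: mE.
- by apply: measurable_funeneg; exact: mE.
- by move=> s /mem_set; exact: funeneg_le.
Qed.

Lemma expect_indep (i : 'I_n) k g : measurable_fun setT k ->
  measurable_fun setT g -> (forall s, 0 <= g s) -> bm g ->
  (forall s x, g (deviate s i x) = g s) ->
  expect (fun s => (k (tnth s i))%:R * g s) = prob k * expect g.
Proof.
move=> mk mg g_ge0 bg gi.
rewrite /expect /Rintegral !integral_profilesE
  (@integral_prod_density_indep _ _ mfab fab_ge0 fab_prob _ i
    (fun x => (k x)%:R))//; last first.
  exact: measurable_fun_boolr.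
(* Both factors must be finite: one is the integral of a bounded function, the other is at most the
   total mass 1. *)
rewrite fineM//; last first.
  by rewrite -integral_profilesE expect_EFin.
rewrite ge0_fin_numE; last first.
  by apply: integral_ge0 => x _; rewrite lee_fin mulr_ge0.
rewrite (@le_lt_trans _ _ 1%E) ?ltry// -fab_prob; apply: ge0_le_integral => //.
- by move=> x _; rewrite lee_fin mulr_ge0.
- apply/measurable_EFinP; apply: measurable_funM => //.
  exact: measurable_fun_boolr.
- exact/measurable_EFinP.
- by move=> x _; rewrite lee_fin ler_piMl//; case: (k x).
Qed.

Lemma prob_ge0 k : 0 <= prob k.
Proof. by apply: Rintegral_ge0 => x _; rewrite mulr_ge0. Qed.

Lemma support_le : a <= b.
Proof.
rewrite leNgt; apply/negP => ba; have [F1 _] := supF.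
move: F1; rewrite set_itv_ge ?measure0 ?bnd_simp -?ltNge// => /eqP.
by rewrite eq_sym onee_eq0.
Qed.

(** The left endpoint [a] belongs to the support, so the open ray below [t] has positive mass; what
    lies outside [[a, b]] is null. *)
Lemma prob_lt_gt0 (t : R) : a < t -> 0 < prob (fun x => x < t).
Proof.
move=> lt_at; have [F1 supE] := supF.
have aS : distribution_support F a.
  by rewrite supE /= in_itv/= lexx support_le.
have := aS `]-oo, t[%classic (@interval_open R -oo%O (BLeft t) isT isT).
rewrite /= in_itv/= => /(_ lt_at).
have F0 : F (`]-oo, t[ `\` `[a, b]) = 0%E.
  apply: (@subset_measure0 _ _ _ F _ (~` `[a, b])) => //.
  - exact: measurableD.
  - exact: measurableC.
  - have -> : 0%E = (1 - F `[a, b]%classic)%E :> \bar R by rewrite F1 subee.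
    exact: probability_setC.
rewrite (measureDI F (B := `[a, b]))//= F0 add0e.
have -> : prob (fun x => x < t) = fine (F (`]-oo, t[ `&` `[a, b])).
  rewrite -integral_fabE// integral_mkcond; congr fine.
  apply: eq_integral => x _; rewrite /patch !mem_setE !in_itv/=.
  by case: (x < t); rewrite ?mul1r ?mul0r.
move=> F_gt0; rewrite fine_gt0// F_gt0 (le_lt_trans (probability_le1 _ _)) ?ltry//.
exact: measurableI.
Qed.

End Expectation.

(** * Probabilities of crossing a grid cell *)

Section Revenue.
Context {R : realType}.
Local Notation mR := (measurableTypeR R).
Variables (n : nat) (a b : R) (F : probability mR R) (f : mR -> R).
Hypotheses (Ff : is_density F f) (supF : full_support F `[a, b]).
Local Notation profile := (n.-tuple mR).
Local Notation D := (profiles (n := n) a b).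
Local Notation bm := (bounded_measurable D).
Local Notation value := (fun _ : 'I_n => @max_signal R n).
Local Notation E := (expect a b f).
Local Notation P := (prob a b f).
Implicit Types (s : profile) (i : 'I_n) (t : R) (y : profile -> R).

(* For [s] in S^n, the maximum of the other signals, and [a] if there are none. *)
Definition max_others i s : R := max_signal (deviate s i a).

Lemma measurable_max_others i : measurable_fun setT (max_others i).
Proof. exact: measurableT_comp measurable_max_signal (measurable_deviate i a). Qed.

Lemma bounded_measurable_max_signal i : bm (@max_signal R n).
Proof.
split; first exact: measurable_funTS measurable_max_signal.
exists (`|a| + `|b|) => s /(max_signal_bounds i) /andP[h1 h2].
have := ler_norm b; have := ler_norm (- a); rewrite normrN.
have := normr_ge0 a; have := normr_ge0 b; rewrite ler_norml => ? ? ? ?.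
by apply/andP; split; lra.
Qed.

Lemma profiles_deviate_bot i s : D s -> D (deviate s i a).
Proof.
move=> Ds; apply: profiles_deviate => //.
by rewrite lexx; have /andP[] := Ds i; exact: le_trans.
Qed.

Lemma bounded_measurable_max_others i : bm (max_others i).
Proof.
split; first exact: measurable_funTS (measurable_max_others i).
have [_ [C hC]] := bounded_measurable_max_signal i.
by exists C => s Ds; apply: hC; exact: profiles_deviate_bot.
Qed.

Lemma measurable_others_lt i t : measurable_fun setT (fun s => max_others i s < t).
Proof. exact: measurable_fun_ltr (measurable_max_others i) (measurable_cst t). Qed.

Lemma bounded_measurable_deviate i t y : measurable_fun D y -> a <= t <= b ->
  (forall s, D s -> 0 <= y s <= 1) -> bm (fun s => y (deviate s i t)).
Proof.
move=> my tab y01; split; last first.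
  exists 1 => s Ds; have /andP[y0 y1] := y01 _ (profiles_deviate i Ds tab).
  by rewrite ger0_norm.
(* As [y] is measurable on [D] only, it is extended by zero before composing; deviations to [t] stay
   inside [D]. *)
have myD : measurable_fun setT (y \_ D).
  by apply/(measurable_restrictT _ _).1 => //; exact: measurable_profiles.
have := measurable_funTS (measurableT_comp myD (measurable_deviate i t)).
move=> /(_ D); apply: eq_measurable_fun => s; rewrite inE => Ds /=.
by rewrite patchE mem_set//; exact: profiles_deviate.
Qed.

(** The factors [max_others i s] and [y (deviate s i t)] ignore signal [i], hence are independent of
    it. *)
Lemma expect_others i (k : mR -> bool) t y : measurable_fun setT k ->
  measurable_fun D y -> a <= t <= b -> (forall s, D s -> 0 <= y s <= 1) ->
  E (fun s => (k (tnth s i))%:R * ((max_others i s < t)%R%:R * y (deviate s i t)))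
  = P k * E (fun s => (max_others i s < t)%R%:R * y (deviate s i t)).
Proof.
move=> mk my tab y01.
have yE s : D s -> (y \_ D) (deviate s i t) = y (deviate s i t).
  by move=> Ds; rewrite patchE mem_set//; exact: profiles_deviate.
have Y01 s : 0 <= (y \_ D) s <= 1.
  by rewrite patchE; case: ifPn => [|_]; [rewrite inE => /y01|rewrite lexx ler01].
have myD : measurable_fun setT (y \_ D).
  by apply/(measurable_restrictT _ _).1 => //; exact: measurable_profiles.
pose g s : R := (max_others i s < t)%R%:R * (y \_ D) (deviate s i t).
have mg : measurable_fun setT g.
  apply: measurable_funM; first exact: measurable_fun_boolr (measurable_others_lt i t).
  exact: measurableT_comp myD (measurable_deviate i t).
have g_ge0 s : 0 <= g s by rewrite mulr_ge0//; have /andP[] := Y01 (deviate s i t).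
have gE s : D s -> g s = (max_others i s < t)%R%:R * y (deviate s i t).
  by move=> Ds; rewrite /g yE.
rewrite -(eq_expect f gE) -(expect_indep (i := i) Ff supF mk mg)//.
- by apply: eq_expect => s Ds; rewrite gE.
- split; first exact: measurable_funTS.
  exists 1 => s _; rewrite ger0_norm// /g.
  by have /andP[_ Y1] := Y01 (deviate s i t); case: (_ < _); rewrite ?mul1r ?mul0r.
- by move=> s x; rewrite /g /max_others !deviate_deviate.
Qed.

Lemma max_signal_lt_others i s t : D s ->
  (max_signal s < t) = (tnth s i < t) && (max_others i s < t).
Proof.
move=> Ds; rewrite (max_signalE (a := a) (i := i)) ?gt_max//.
by have /andP[] := Ds i.
Qed.

(** By [expect_others], both sides equal P(s_i < t) P(s_i >= t') E[1{m_i < t} y(t, s_{-i})]. The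
    event on the right is the same for all agents, which allows summation over [i]. *)
Lemma expect_exchange i t (t' : R) y :
  measurable_fun D y -> a <= t <= b -> (forall s, D s -> 0 <= y s <= 1) ->
  P (fun x => x < t) *
    E (fun s => ((max_others i s < t) && (t' <= tnth s i))%R%:R * y (deviate s i t))
  = P (fun x => t' <= x) * E (fun s => (max_signal s < t)%R%:R * y (deviate s i t)).
Proof.
move=> my tab y01.
transitivity (P (fun x => x < t) * (P (fun x => t' <= x) *
    E (fun s => (max_others i s < t)%R%:R * y (deviate s i t)))).
  rewrite -expect_others//; last first.
    exact: measurable_fun_ler (measurable_cst _) (@measurable_id _ _ _).
  by congr (_ * _); apply: eq_expect => s _; rewrite andbC -mulnb natrM mulrA.
rewrite mulrCA; congr (_ * _); rewrite -expect_others//; last first.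
  exact: measurable_fun_ltr (@measurable_id _ _ _) (measurable_cst _).
apply: eq_expect => s Ds.
by rewrite (max_signal_lt_others i t Ds) -mulnb natrM mulrA.
Qed.

Variable d : R.
Hypothesis d_gt0 : 0 < d.

(* The probability that [s_i >= grid a d k.+1] while all the other signals are
   below [grid a d k]; in this form it visibly does not depend on [i]. *)
Definition cross_prob k : R :=
  P (fun x => grid a d k.+1 <= x) * E (fun s => (max_signal s < grid a d k)%R%:R)
    / P (fun x => x < grid a d k).

Lemma prob_lt_grid_gt0 k : 0 < P (fun x => x < grid a d k).
Proof.
apply: (prob_lt_gt0 Ff supF); rewrite /grid ltrDl mulr_gt0// ltr0n.
Qed.

(** The case [y = 1] of the exchange, divided by the positive probability of a signal below the grid
    point. *)
Lemma expect_crosses i k : grid a d k <= b ->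
  E (fun s => (crosses a d s i k)%:R) = cross_prob k.
Proof.
move=> kb.
have ab : a <= grid a d k <= b by rewrite kb (grid_ge _ (ltW d_gt0)).
have := expect_exchange i (grid a d k.+1) (y := cst 1) (measurable_cst _) ab.
rewrite /= => /(_ (fun s _ => _)) => H.
apply: (mulfI (lt0r_neq0 (prob_lt_grid_gt0 k))).
rewrite /cross_prob mulrC [RHS]mulrC divfK ?(lt0r_neq0 (prob_lt_grid_gt0 k))// mulrC.
have := H; under eq_expect do rewrite mulr1.
move=> ->; last by rewrite ler01 lexx.
by congr (_ * _); apply: eq_expect => s _; rewrite mulr1.
Qed.

Lemma bounded_measurable_crosses i k : bm (fun s => (crosses a d s i k)%:R : R).
Proof.
apply: bounded_measurable_bool; rewrite /crosses; apply: measurable_and.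
  exact: measurable_others_lt.
apply: measurable_fun_ler => //; exact: (@measurable_tnth _ mR).
Qed.

Lemma bounded_measurable_max_lt t : bm (fun s => (max_signal s < t)%R%:R : R).
Proof.
apply: bounded_measurable_bool.
exact: measurable_fun_ltr measurable_max_signal (measurable_cst _).
Qed.

(** After clearing the denominator, the exchange turns every summand into an expectation over the
    common event that all signals are below the grid point. There [EPIC_le] bounds the allocation
    from below by [q i s], and these sum to 1. *)
Lemma sum_expect_crosses_ge (q p : 'I_n -> profile -> R) k :
  admissible a b value q p -> grid a d k <= b ->
  cross_prob k <=
    \sum_(i < n)
      E (fun s => (crosses a d s i k)%:R * q i (deviate s i (grid a d k))).
Proof.
move=> [mech sale ic _] kb.
have ab : a <= grid a d k <= b by rewrite kb (grid_ge _ (ltW d_gt0)).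
have mq i : measurable_fun D (q i) by have [] := mech i.
have q01 i s : D s -> 0 <= q i s <= 1 by have [_ _] := mech i; exact.
have bq i : bm (q i).
  split => //; exists 1 => s /(q01 i) /andP[q0 q1].
  by rewrite ger0_norm.
rewrite ler_pdivrMr ?prob_lt_grid_gt0// [leRHS]mulrC mulr_sumr.
under [leRHS]eq_bigr do rewrite (expect_exchange _ _ (mq _) ab (q01 _)).
rewrite -mulr_sumr ler_wpM2l ?(prob_ge0 _ _ Ff)//.
apply: (@le_trans _ _
    (\sum_(i < n) E (fun s => (max_signal s < grid a d k)%R%:R * q i s))).
  rewrite -(expect_sum Ff supF) => [|i]; last first.
    exact: bounded_measurableM (bounded_measurable_max_lt _) (bq i).
  rewrite le_eqVlt; apply/orP; left; apply/eqP; apply: eq_expect => s Ds.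
  by rewrite -mulr_sumr sale// mulr1.
apply: ler_sum => i _; apply: (le_expect Ff supF).
- exact: bounded_measurableM (bounded_measurable_max_lt _) (bq i).
- apply: bounded_measurableM (bounded_measurable_max_lt _) _.
  exact: bounded_measurable_deviate (mq i) ab (q01 i).
- move=> s Ds; case: ltP => Mk; rewrite ?mul0r// !mul1r.
  exact: EPIC_le ic Ds ab ((max_signal_ltP i s _).1 Mk).
Qed.

End Revenue.

(** * Upper bound on revenue and its attainment up to the mesh *)

Section RevenueBound.
Context {R : realType}.
Local Notation mR := (measurableTypeR R).
Variables (n : nat) (a b : R) (F : probability mR R) (f : mR -> R).
Hypotheses (Ff : is_density F f) (supF : full_support F `[a, b]).
Local Notation profile := (n.-tuple mR).
Local Notation D := (profiles (n := n) a b).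
Local Notation value := (fun _ : 'I_n => @max_signal R n).
Local Notation E := (expect a b f).

Lemma support_lt : a < b.
Proof.
rewrite lt_neqAle (support_le supF) andbT; apply/eqP => ab.
have [+ _] := supF; have [_ _ ->//] := Ff.
by rewrite -ab set_itv1 integral_set1 => /eqP; rewrite eq_sym onee_eq0.
Qed.

(** Revenue is surplus minus rents. Mandatory sale makes the surplus equal to the highest signal,
    and the envelope bound makes the expected rents at least the sum over the grid. *)
Lemma revenue_le_grid (q p : 'I_n -> profile -> R) d J (i0 : 'I_n) :
  0 < d -> grid a d J = b -> admissible a b value q p ->
  (revenue a b f p <=
   (E (@max_signal R n) - d * \sum_(k < J) cross_prob n a b f d k)%:E)%E.
Proof.
move=> d_gt0 gJ adm; have [mech sale ic ir] := adm.
have gk (k : 'I_J) : grid a d k <= b.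
  by rewrite -gJ; apply: le_grid; [exact: ltW|exact: ltnW].
have ak k : a <= grid a d k by apply: grid_ge; exact: ltW.
have mq i : measurable_fun D (q i) by have [] := mech i.
have q01 i s : D s -> 0 <= q i s <= 1 by have [_ _] := mech i; exact.
have bq i : bounded_measurable D (q i).
  by split => //; exists 1 => s /(q01 i) /andP[q0 q1]; rewrite ger0_norm.
have bqM i : bounded_measurable D (fun s => q i s * max_signal s).
  exact: bounded_measurableM (bq i) (bounded_measurable_max_signal a b i0).
pose z i k (s : profile) : R :=
  (crosses a d s i k)%:R * q i (deviate s i (grid a d k)).
have bz i (k : 'I_J) : bounded_measurable D (z i k).
  apply: bounded_measurableM; first exact: bounded_measurable_crosses.
  by apply: bounded_measurable_deviate (mq i) _ (q01 i); rewrite ak gk.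
have bdz i : bounded_measurable D (fun s => d * \sum_(k < J) z i k s).
  by apply: bounded_measurableZ; apply: bounded_measurable_sum.
have zE i : E (fun s => d * \sum_(k < J) z i k s) = d * \sum_(k < J) E (z i k).
  rewrite (expectZ Ff supF); last exact: bounded_measurable_sum (bz i).
  by rewrite (expect_sum Ff supF _ (bz i)).
apply: (@le_trans _ _
    (\sum_(i < n)
      (E (fun s => q i s * max_signal s - d * \sum_(k < J) z i k s)%R)%:E)%E).
  apply: lee_sum => i _.
  apply: (integral_le_expect Ff supF); first by have [] := mech i.
    exact: bounded_measurableB.
  have q_ge0 s : D s -> 0 <= q i s by move=> /(q01 i) /andP[].
  move=> s Ds; have := net_payoff_ge (ltW d_gt0) J ic ir q_ge0 Ds.
  by rewrite /net_payoff /z; lra.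
rewrite sumEFin lee_fin.
under eq_bigr do rewrite (expectB Ff supF (bqM _) (bdz _)).
rewrite sumrB; apply: lerB.
  rewrite -(expect_sum Ff supF)// le_eqVlt; apply/orP; left; apply/eqP.
  by apply: eq_expect => s Ds; rewrite -mulr_suml sale// mul1r.
under [leRHS]eq_bigr do rewrite zE.
rewrite -mulr_sumr ler_wpM2l ?(ltW d_gt0)// exchange_big/=.
apply: ler_sum => k _; rewrite /z.
exact (sum_expect_crosses_ge Ff supF d_gt0 adm (gk k)).
Qed.

(** For each single agent, the expected highest competing signal reaches the bound of
    [revenue_le_grid] up to [d *+ 2]: integrate [max_signal_gap_le] and use [expect_crosses]. *)
Lemma expect_max_others_ge d J (i : 'I_n) :
  0 < d -> grid a d J = b ->
  E (@max_signal R n) - d * \sum_(k < J) cross_prob n a b f d k - d *+ 2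
    <= E (max_others a i).
Proof.
move=> d_gt0 gJ.
have bc (k : 'I_J) : bounded_measurable D (fun s => (crosses a d s i k)%:R : R).
  exact: bounded_measurable_crosses.
have bdc : bounded_measurable D (fun s => d * \sum_(k < J) (crosses a d s i k)%:R).
  by apply: bounded_measurableZ; apply: bounded_measurable_sum.
have bM := bounded_measurable_max_signal a b i.
have bm := bounded_measurable_max_others a b i.
have -> : d * \sum_(k < J) cross_prob n a b f d k =
    E (fun s => d * \sum_(k < J) (crosses a d s i k)%:R).
  rewrite (expectZ Ff supF); last exact: bounded_measurable_sum bc.
  rewrite (expect_sum Ff supF); last exact: bc.
  congr (_ * _); apply: eq_bigr => k _; rewrite (expect_crosses Ff supF)//.
  by rewrite -gJ; apply: le_grid; [exact: ltW|exact: ltnW].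
have <- : E (cst (d *+ 2) : profile -> R) = d *+ 2.
  rewrite -[RHS]mulr1 -(expect1 n Ff supF) -(expectZ Ff supF); last first.
    exact: bounded_measurable_cst.
  by apply: eq_expect => s _; rewrite mulr1.
have b2 := bounded_measurable_cst D (d *+ 2).
rewrite -!(expectB Ff supF)//; last exact: bounded_measurableB.
apply: (le_expect Ff supF) => //; first by do 2 apply: bounded_measurableB => //.
move=> s Ds.
have := @max_signal_gap_le _ _ a d (ltW d_gt0) s i J.
rewrite gJ => /(_ (Ds i)) H.
have := H (proj1 (andP (max_signal_bounds i (profiles_deviate_bot i Ds)))).
by rewrite /max_others /=; lra.
Qed.

End RevenueBound.

(** * Optimality of the constant allocation rule *)

Theorem proposition4 (R : realType) (n : nat) (a b : R)
    (F : probability (measurableTypeR R) R) (f : R -> R)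
    (c : 'I_n -> R) (q : 'I_n -> n.-tuple (measurableTypeR R) -> R) :
  is_density F f ->
  full_support F `[a, b] ->
  (forall i, 0 <= c i <= 1) ->
  \sum_(i < n) c i = 1 ->
  (forall i s, profiles a b s -> q i s = c i) ->
  exists p : 'I_n -> n.-tuple (measurableTypeR R) -> R,
    optimal a b (fun _ => max_signal) f q p.
Proof.
move=> Ff supF c01 c1 qc.
have c_ge0 i : 0 <= c i by have /andP[] := c01 i.
(* The weights sum to 1, so there is at least one agent. *)
have [i0 _] : exists i : 'I_n, c i != 0.
  apply/existsP; apply: contraPT c1 => /existsPn c0.
  by rewrite big1 => [/eqP|i _]; [rewrite eq_sym oner_eq0|exact/eqP/negPn/c0].
pose p i s := c i * max_others a i s.
have bp i : bounded_measurable (profiles a b) (p i).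
  exact: bounded_measurableZ (bounded_measurable_max_others a b i).
exists p; split; last first.
  move=> q' p' adm.
  have -> : revenue a b f p = (\sum_(i < n) c i * expect a b f (max_others a i))%:E.
    rewrite -sumEFin; apply: eq_bigr => i _; rewrite (expect_EFin Ff supF (bp i)).
    by rewrite (expectZ Ff supF)//; exact: bounded_measurable_max_others.
  apply/lee_addgt0Pr => e e_gt0.
  (* [J] makes [d *+ 2 <= e]. The divisor is [J.+1] because [grid a d J] is [a + d * J.+1], which
     has to be [b]. *)
  pose J := Num.truncn (2 * (b - a) / e).
  pose d := (b - a) / J.+1%:R.
  have ab : 0 < b - a by rewrite subr_gt0; exact: support_lt Ff supF.
  have d_gt0 : 0 < d by rewrite divr_gt0.
  have gJ : grid a d J = b by rewrite /grid divfK ?pnatr_eq0// addrC subrK.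
  have de : d *+ 2 <= e.
    have := truncnS_gt (2 * (b - a) / e); rewrite -/J ltr_pdivrMr// => h.
    by rewrite -mulr_natr /d mulrAC ler_pdivrMr ?ltr0n//; lra.
  apply: le_trans (revenue_le_grid Ff supF i0 d_gt0 gJ adm) _.
  rewrite -EFinD lee_fin -lerBlDr.
  set L := expect a b f (@max_signal R n) - _.
  apply: (@le_trans _ _ (L - d *+ 2)); first by rewrite lerD2l lerN2.
  (* The lower bound is the same for every agent, so it survives averaging with the weights
     [c i]. *)
  rewrite -[leLHS]mul1r -c1 mulr_suml; apply: ler_sum => i _.
  by rewrite ler_wpM2l//; exact: (expect_max_others_ge Ff supF i d_gt0 gJ).
split.
- move=> i; split.
  + apply: (eq_measurable_fun (cst (c i))) (measurable_cst _) => s.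
    by rewrite inE => /qc ->.
  + by have [] := bp i.
  + by move=> s /qc ->.
- by move=> s Ds; rewrite -[RHS]c1; apply: eq_bigr => i _; rewrite qc.
(* A deviation by [i] changes neither the payment nor the allocation, so EPIC holds with
   equality. *)
- move=> i s x Ds xab /=; have Dx := profiles_deviate i Ds xab.
  rewrite /net_payoff /p /max_others deviate_deviate !qc//.
  lra.
- move=> i s Ds; rewrite /net_payoff /p qc// -mulrBr mulr_ge0// subr_ge0.
  have /andP[asi _] := Ds i.
  by rewrite (max_signalE asi) le_max lexx orbT.
Qed.
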